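(* For every $\rho,A>0$ there are constants $K=K(\rho,A)$ and $p_0=p_0(\rho,A)$ such that the following holds whenever $p\ge p_0$. Let $F$ be a graph with at most $p^A$ nonisolated vertices, $m$ edges, and $t$ triangles. Let $L(v)$, $v\in V(F)$, be lists that are subsets of a common palette $\mathcal P$ of $p$ colors, with $$|L(v)|\ge\rho p\qquad(v\in V(F)).$$ If $$K\left(\frac{m^{1/3}}{\operatorname{Log}^{2/3}m}+t^{1/3}\right)\le p,$$ then $F$ is $L$-colorable.
   Context: All graphs are finite and simple. For real $x\ge0$, $\operatorname{Log}x=\max\{1,\log(\max\{x,1\})\}$ with $\log$ the natural logarithm (so $\operatorname{Log}0=1$), and $\operatorname{Log}^a x=(\operatorname{Log}x)^a$. A graph $F$ with a list $L(v)$ of colors at each vertex is $L$-colorable if it has a proper vertex coloring assigning to each vertex $v$ a color from $L(v)$. *)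

(* Defs.v *)
From HB Require Import structures.
From mathcomp Require Import all_boot all_order all_algebra.
From mathcomp Require Import reals exp.
Set Implicit Arguments.
Unset Strict Implicit.
Unset Printing Implicit Defensive.
Import Order.TTheory GRing.Theory Num.Theory.
Local Open Scope ring_scope.

Definition Log (R : realType) (x : R) : R := Num.max 1 (ln (Num.max x 1)).

(* A finite simple graph is a symmetric irreflexive relation on a finType. *)
Section Graph.
Variables (V : finType) (adj : rel V).

Definition simple_graph : Prop := symmetric adj /\ irreflexive adj.

Definition nonisolated : {set V} := [set v | [exists u, adj v u]].

Definition edges : {set {set V}} :=
  [set [set uv.1; uv.2] | uv : V * V & adj uv.1 uv.2].

Definition triangles : {set {set V}} :=
  [set S : {set V} | (#|S| == 3%N) &&
    [forall u in S, forall v in S, (u != v) ==> adj u v]].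

Definition list_colorable (C : finType) (L : V -> {set C}) : Prop :=
  exists c : V -> C,
    (forall v, c v \in L v) /\ (forall u v, adj u v -> c u != c v).

End Graph.

(* Main.v *)
Require Import Defs.
From mathcomp Require Import all_boot all_order all_algebra.
From mathcomp Require Import reals sequences exp.
From mathcomp Require Import ring lra.
Set Implicit Arguments.
Unset Strict Implicit.
Unset Printing Implicit Defensive.
Import Order.TTheory GRing.Theory Num.Theory.
Local Open Scope ring_scope.

(** Write q for the number of colors and ell = ln q.  The hypothesis says that
    there are at most eps q^3 ell^2 edges and eps q^3 triangles, where eps is as
    small as desired compared to rho: the bound q^A on the number of nonisolated
    vertices makes Log m at most a multiple of ell.

    The coloring is built greedily, one color class at a time.  As long as at
    most rho q / 2 colors have been spent, every list still has b = rho q / 2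
    unspent colors.  Hence a vertex with fewer than b uncolored neighbors can be
    set aside and colored at the very end, and one may assume that all degrees in
    the set W of uncolored vertices are at least b.  Moreover any S inside W has
    a popular unspent color, lying in the lists of a proportion rho / 2 of S, so
    an independent subset of S of the expected order can always be colored with a
    single new color.  Everything therefore rests on finding large independent
    sets in W, so large that the number of rounds is at most rho q / 2.  The
    rounds are counted by a potential Psi that drops by one in each of them
    (potential_coloring); with n = |W|, there are three regimes.

    - n <= eta q^2.  Take a vertex v of W lying in the fewest triangles, say T.
      Its neighborhood has at least b vertices and T edges.  If T is smaller
      than the number of vertices, Turan gives an independent set of order q,
      which can happen O(eta q) times.  Otherwise Turan gives order q^2 / T
      vertices; each lies in at least T triangles, so removing them destroys
      order q^2 triangles, which can happen O(eps q) times (small_step).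

    - eta q^2 <= n <= sig^2 q^2 ell.  Most vertices are in at most q triangles.
      Put D = sqrt (n ell).  A vertex of degree above D has an independent set of
      order D in its neighborhood; if there is none, the maximum degree is at most
      D and there is an independent set of order n ell / D = D (middle_step).
      Such steps lower sqrt n by order sqrt ell, hence are O(sig q) in number.

    - n >= sig^2 q^2 ell.  The average degree is of order at most
      D = eps q^3 ell^2 / n, and there is an independent set of order n ell / D
      (large_step).  Such steps raise 1 / n by order 1 / (eps q^3 ell), hence are
      O(eps q / sig^2) in number.

    The independent sets of order n ell / D, a factor ell better than Turan, come
    from a weighted form of Shearer's argument for triangle-free graphs
    (hc_independent).  Draw a random independent set with probability
    proportional to lam^|I|.  Given I outside the closed neighborhood of v, what
    remains at v is either v itself or an independent subset of the unblocked
    neighbors.  If few neighbors are unblocked, v is likely to be picked; if many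
    are, many of them are picked.  Thus D [v in I] + |I cap N(v)| is of order ell
    on average in both cases, and summing over v gives 2 D E|I| >= order n ell.
    The weight lam = q^(-1/2) makes the random set so thin that the up to q
    edges inside a neighborhood do not matter. *)

(** * Ordered adjacent pairs, ordered triangles and independent sets *)

Section IndependentSets.
Variables (V : finType) (adj : rel V).
Hypotheses (adjC : symmetric adj) (adjI : irreflexive adj).
Implicit Types (X Y B I J W : {set V}) (u v w : V).

Definition indep I : bool := [forall u in I, forall v in I, ~~ adj u v].
Definition nbhd X v : {set V} := [set u in X | adj v u].
(** Counting ordered pairs and triples keeps every double count a plain sum, at the
    price of constant factors. *)
Definition adjpairs X : nat := \sum_(u in X) #|nbhd X u|.
Definition ordtri X : nat := \sum_(u in X) adjpairs (nbhd X u).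
Definition unblocked B I : {set V} := [set w in B | [forall u in I, ~~ adj u w]].

Lemma indepP I : reflect {in I &, forall u v, ~~ adj u v} (indep I).
Proof.
apply: (iffP forall_inP) => [H u v uI vI|H u uI]; first exact: (forall_inP (H u uI)).
by apply/forall_inP => v vI; apply: H.
Qed.

Lemma indepS I J : I \subset J -> indep J -> indep I.
Proof.
move=> /subsetP sIJ /indepP iJ; apply/indepP => u v uI vI.
by apply: iJ; apply: sIJ.
Qed.

Lemma indep0 : indep set0.
Proof. by apply/indepP => u v; rewrite inE. Qed.

Lemma nbhdS X Y v : X \subset Y -> nbhd X v \subset nbhd Y v.
Proof. by move=> /subsetP s; apply/subsetP => u; rewrite !inE => /andP[/s-> ->]. Qed.

Lemma adjpairsS X Y : X \subset Y -> (adjpairs X <= adjpairs Y)%N.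
Proof.
move=> s; rewrite /adjpairs (big_setID X (A := Y)) /= (setIidPr s).
apply: leq_trans (leq_addr _ _); apply: leq_sum => u _.
exact: subset_leq_card (nbhdS _ s).
Qed.

Lemma ordtriS X Y : X \subset Y -> (ordtri X <= ordtri Y)%N.
Proof.
move=> s; rewrite /ordtri (big_setID X (A := Y)) /= (setIidPr s).
apply: leq_trans (leq_addr _ _); apply: leq_sum => u _.
exact: adjpairsS (nbhdS _ s).
Qed.

Lemma ordtri_setD W I : I \subset W ->
  (ordtri (W :\: I) + \sum_(u in I) adjpairs (nbhd W u) <= ordtri W)%N.
Proof.
move=> s; rewrite [leqRHS](big_setID I) /= (setIidPr s) addnC leq_add2l.
apply: leq_sum => u _; apply: adjpairsS; apply: nbhdS; exact: subsetDl.
Qed.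

Lemma exists_minimizer (f : V -> nat) W : W != set0 ->
  exists2 v, v \in W & {in W, forall u, (f v <= f u)%N}.
Proof. by case/set0Pn => v vW; case: (arg_minnP f vW) => w wW H; exists w. Qed.

(** The hard-core model: independent sets weighted by lam to the cardinality. *)
Section HardCore.
Variables (R : realType) (lam : R).
Hypothesis lam0 : 0 < lam.

Definition hcsum X (F : {set V} -> R) : R :=
  \sum_(I : {set V} | (I \subset X) && indep I) lam ^+ #|I| * F I.

(** Removing u from an independent set that contains it leaves an arbitrary
    independent set avoiding the closed neighborhood of u. *)
Lemma hcsum_pin X u F : u \in X ->
  hcsum X (fun I => (u \in I)%:R * F I) = lam * hcsum ((X :\ u) :\: nbhd X u) (fun J => F (u |: J)).
Proof.
move=> uX; rewrite /hcsum.
rewrite (bigID (fun I : {set V} => u \in I)) /= [X in _ + X]big1 ?addr0; last first.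
  by move=> I /andP[_ /negPf->]; rewrite mul0r mulr0.
rewrite (reindex_onto (fun J => u |: J) (fun I => I :\ u)) /=; last first.
  by move=> I /andP[_ uI]; rewrite setD1K.
rewrite mulr_sumr; apply: eq_big => J; last first.
  move=> /andP[/andP[_ _] /eqP e].
  have uJ : u \notin J by rewrite -e !inE eqxx.
  by rewrite cardsU1 uJ exprS setU11 mul1r mulrA.
apply/idP/idP.
  move=> /andP[/andP[/andP[/subsetP s /indepP i] _] /eqP e].
  have uJ : u \notin J by rewrite -e !inE eqxx.
  apply/andP; split; last by apply: (indepS (subsetUr [set u] J)); apply/indepP.
  apply/subsetP => w wJ; rewrite !inE (s w) ?inE ?wJ ?orbT // andbT.
  by rewrite i ?inE ?eqxx ?wJ ?orbT //=; apply: contraNneq uJ => <-.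
move=> /andP[/subsetP s /indepP i].
have uJ : u \notin J by apply/negP => /s; rewrite !inE eqxx /= andbF.
rewrite setU11 setU1K // eqxx !andbT; apply/andP; split.
  by apply/subsetP => w; rewrite !inE => /orP[/eqP->//|/s]; rewrite !inE => /and3P[].
have nJ w : w \in J -> ~~ adj u w.
  by move=> /s; rewrite !inE => /and3P[+ _ wX]; rewrite wX.
apply/indepP => a b; rewrite !inE => /orP[/eqP->|aJ] /orP[/eqP->|bJ].
- by rewrite adjI.
- exact: nJ.
- by rewrite adjC nJ.
- exact: i.
Qed.

(** The Markov property of the model: once the part outside B is revealed, what
    happens in B is the same model on the vertices that are not blocked. *)
Lemma hcsum_split X B F : B \subset X ->
  hcsum X (fun I => F (I :&: B)) = hcsum (X :\: B) (fun I => hcsum (unblocked B I) F).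
Proof.
move=> /subsetP sBX; rewrite /hcsum.
rewrite (partition_big (fun I => I :\: B)
  (fun I => (I \subset X :\: B) && indep I)) /=; last first.
  move=> I /andP[s i]; rewrite setSD //=; apply: indepS i; exact: subsetDl.
apply: eq_bigr => K /andP[/subsetP sK /indepP iK].
have KB w : w \in K -> w \notin B by move=> /sK; rewrite inE => /andP[].
rewrite (reindex_onto (fun J => K :|: J) (fun I => I :&: B)) /=; last first.
  by move=> I /andP[_ /eqP <-]; rewrite setUC setID.
rewrite mulr_sumr; apply: eq_big => J; last first.
  move=> /andP[/andP[_ _] /eqP e]; rewrite e cardsU.
  suff -> : K :&: J = set0 by rewrite cards0 subn0 exprD mulrA.
  apply/setP => w; rewrite !inE; apply/negP => /andP[/KB wB].
  by rewrite -e inE (negPf wB) andbF.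
apply/idP/idP.
  move=> /andP[/andP[/andP[/subsetP s /indepP i] _] /eqP e].
  apply/andP; split; last by apply: (indepS (subsetUr K J)); apply/indepP.
  apply/subsetP => w wJ; rewrite inE; apply/andP; split.
    by move: wJ; rewrite -e inE => /andP[].
  by apply/forall_inP => u uK; apply: i; rewrite inE ?uK ?wJ ?orbT.
move=> /andP[/subsetP s /indepP i].
have JB w : w \in J -> w \in B by move=> /s; rewrite inE => /andP[].
have JK u w : u \in K -> w \in J -> ~~ adj u w.
  by move=> uK /s; rewrite inE => /andP[_ /forall_inP]; apply.
apply/andP; split; first (apply/andP; split; first (apply/andP; split)).
- apply/subsetP => w; rewrite inE => /orP[/sK|/JB /sBX //].
  by rewrite inE => /andP[].
- apply/indepP => a b; rewrite !inE => /orP[aK|aJ] /orP[bK|bJ].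
  + exact: iK. + exact: JK. + by rewrite adjC JK. + exact: i.
- apply/eqP/setP => w; rewrite !inE; case wK: (w \in K) => /=.
    by rewrite KB.
  by case wJ: (w \in J); rewrite ?andbF // JB.
- apply/eqP/setP => w; rewrite !inE; case wK: (w \in K) => /=.
    rewrite (negPf (KB _ wK)); apply/esym/negP => /JB; exact/negP/KB.
  by case wJ: (w \in J); rewrite ?andbF //= JB.
Qed.

Lemma hcsum_le X F G : (forall I, I \subset X -> indep I -> F I <= G I) ->
  hcsum X F <= hcsum X G.
Proof.
move=> H; apply: ler_sum => I /andP[s i]; rewrite ler_wpM2l ?H //.
by rewrite exprn_ge0 // ltW.
Qed.

Lemma hcsum_eq X F G : (forall I, I \subset X -> F I = G I) -> hcsum X F = hcsum X G.
Proof. by move=> H; apply: eq_bigr => I /andP[s i]; rewrite H. Qed.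

Lemma hcsum_sum (T : finType) (P : pred T) X (F : T -> {set V} -> R) :
  hcsum X (fun I => \sum_(i | P i) F i I) = \sum_(i | P i) hcsum X (F i).
Proof. by rewrite exchange_big; apply: eq_bigr => I _; rewrite mulr_sumr. Qed.

Lemma hcsumD X F G : hcsum X (fun I => F I + G I) = hcsum X F + hcsum X G.
Proof. by rewrite -big_split; apply: eq_bigr => I _; rewrite mulrDr. Qed.

Lemma hcsumZ X (c : R) F : hcsum X (fun I => c * F I) = c * hcsum X F.
Proof. by rewrite mulr_sumr; apply: eq_bigr => I _; rewrite mulrCA. Qed.

(** The partition function of the hard-core model. *)
Definition hcpart X := hcsum X (fun=> 1).
Notation Z := hcpart.

Lemma hcsum_cst X (c : R) : hcsum X (fun=> c) = c * Z X.
Proof. by rewrite -hcsumZ; apply: hcsum_eq => I _; rewrite mulr1. Qed.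

Lemma hcsumS X Y F : X \subset Y -> (forall I, 0 <= F I) -> hcsum X F <= hcsum Y F.
Proof.
move=> s F0; rewrite /hcsum [leRHS](bigID (fun I : {set V} => I \subset X)) /=.
rewrite -[leLHS]addr0 lerD //.
  rewrite le_eqVlt; apply/orP; left; apply/eqP/eq_bigl => I.
  by case sI: (I \subset X); rewrite ?andbF //= (subset_trans sI s) andbT.
by apply: sumr_ge0 => I _; rewrite mulr_ge0 ?exprn_ge0 // ltW.
Qed.

Lemma hcpart_gt0 X : 0 < Z X.
Proof.
rewrite /hcpart /hcsum (bigD1 set0) /=; last by rewrite sub0set indep0.
rewrite cards0 expr0 mulr1; apply: ltr_wpDr => //.
by apply: sumr_ge0 => I _; rewrite mulr_ge0 ?exprn_ge0 // ltW.
Qed.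

Lemma hcsum_mem X u : u \in X ->
  hcsum X (fun I => (u \in I)%:R) = lam * Z ((X :\ u) :\: nbhd X u).
Proof.
by move=> uX; rewrite -(hcsum_pin (fun=> 1)) //; apply: hcsum_eq => I _; rewrite mulr1.
Qed.

Lemma hcsum_mem_le X u : u \in X -> hcsum X (fun I => (u \in I)%:R) <= lam * Z X.
Proof.
move=> uX; rewrite hcsum_mem // ler_pM2l //; apply: hcsumS => //.
by apply: subset_trans (subsetDl _ _) (subsetDl _ _).
Qed.

Lemma hcsum_notin X v F : hcsum X (fun I => (v \notin I)%:R * F I) = hcsum (X :\ v) F.
Proof.
rewrite /hcsum (bigID (fun I : {set V} => v \in I)) /= [X in X + _]big1.
  rewrite add0r; apply: eq_big => [I|I]; first by rewrite subsetD1 andbAC.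
  by move=> /andP[_ ->]; rewrite mul1r.
by move=> I /andP[_ ->]; rewrite mul0r mulr0.
Qed.

Lemma hcpart_le_expR X : Z X <= expR (lam * #|X|%:R).
Proof.
have [n] := ubnP #|X|; elim: n X => // n IH X /ltnSE le.
have [->|/set0Pn [u uX]] := eqVneq X set0.
  rewrite cards0 mulr0 expR0 /hcpart /hcsum (big_pred1 set0) ?cards0 ?expr0 ?mulr1 //.
  by move=> I; rewrite subset0 /=; case: eqP => [->|//]; rewrite indep0.
have c : #|X| = #|X :\ u|.+1 by rewrite (cardsD1 u) uX.
rewrite c -natr1 mulrDr mulr1 expRD.
have {}IH : Z (X :\ u) <= expR (lam * #|X :\ u|%:R) by apply: IH; rewrite -c.
have -> : Z X = Z (X :\ u) + hcsum X (fun I => (u \in I)%:R).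
  rewrite /hcpart -(hcsum_notin X) -hcsumD; apply: hcsum_eq => I _.
  by case: (u \in I); rewrite ?mulr1 ?addr0 ?add0r.
rewrite hcsum_mem //.
have le1 : Z ((X :\ u) :\: nbhd X u) <= Z (X :\ u) by apply: hcsumS => //; exact: subsetDl.
apply: (@le_trans _ _ (Z (X :\ u) * expR lam)); last by rewrite ler_wpM2r ?expR_ge0.
apply: (@le_trans _ _ (Z (X :\ u) * (1 + lam))).
  by rewrite mulrDr mulr1 lerD2l mulrC ler_wpM2r // ltW.
by rewrite ler_pM2l ?hcpart_gt0 ?expR_ge1Dx.
Qed.

Lemma hcsum_card X :
  hcsum X (fun I => #|I|%:R) = \sum_(u in X) hcsum X (fun I => (u \in I)%:R).
Proof.
rewrite -hcsum_sum; apply: hcsum_eq => I /subsetP s.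
rewrite -sum1_card natr_sum big_mkcond [RHS]big_mkcond /=; apply: eq_bigr => u _.
by case uI: (u \in I); [rewrite (s _ uI) | case: ifP].
Qed.

(** A vertex u is picked as often as its closed neighborhood is missed, up to the
    factor lam, and by a union bound it is missed with probability at least
    1 - lam (1 + deg u).  Summing over u turns the degrees into adjpairs X. *)
Lemma hcsum_card_ge X :
  lam * (#|X|%:R - lam * (#|X| + adjpairs X)%:R) * Z X <= hcsum X (fun I => #|I|%:R).
Proof.
rewrite hcsum_card.
suff H u : u \in X -> lam * (1 - lam * (1 + #|nbhd X u|%:R)) * Z X
    <= hcsum X (fun I => (u \in I)%:R).
  apply: le_trans (ler_sum _ H).
  rewrite -mulr_suml -mulr_sumr sumrB -mulr_sumr big_split /= sumr_const -natr_sum.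
  by rewrite natrD /adjpairs.
move=> uX; rewrite hcsum_mem // -mulrA ler_pM2l //.
have : Z X <= Z ((X :\ u) :\: nbhd X u) + (hcsum X (fun I => (u \in I)%:R) +
    \sum_(w in nbhd X u) hcsum X (fun I => (w \in I)%:R)).
  have -> : Z ((X :\ u) :\: nbhd X u) =
      hcsum X (fun I => (I \subset (X :\ u) :\: nbhd X u)%:R).
    rewrite /hcpart /hcsum [RHS](bigID (fun I : {set V} => I \subset (X :\ u) :\: nbhd X u)) /=.
    rewrite [X in _ = _ + X]big1 ?addr0; last by move=> I /andP[_ /negPf->]; rewrite mulr0.
    apply: eq_big => [I|I /andP[->] //].
    case s: (I \subset _ :\: _); rewrite ?andbF //= andbT.
    by rewrite (subset_trans s) // (subset_trans (subsetDl _ _)) // subsetDl.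
  rewrite -hcsum_sum -!hcsumD; apply: hcsum_le => I sI iI.
  have [|] := boolP (I \subset (X :\ u) :\: nbhd X u) => [_|].
    by rewrite lerDl addr_ge0 // sumr_ge0.
  rewrite add0r => /subsetPn [w wI]; rewrite !inE (subsetP sI _ wI) andbT /= negb_and negbK.
  case/orP => [uw|/negPn/eqP <-]; last by rewrite wI lerDl sumr_ge0.
  rewrite (bigD1 w) ?inE ?(subsetP sI _ wI) //= wI addrCA lerDl addr_ge0 // sumr_ge0 //.
have : \sum_(w in nbhd X u) hcsum X (fun I => (w \in I)%:R) <= #|nbhd X u|%:R * (lam * Z X).
  rewrite mulr_natl -sumr_const; apply: ler_sum => w; rewrite inE => /andP[wX _].
  exact: hcsum_mem_le.
have := hcsum_mem_le uX; lra.
Qed.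

(** The first moment method. *)
Lemma hcsum_exists X F : 0 <= hcsum X F ->
  exists I, [/\ I \subset X, indep I & 0 <= F I].
Proof.
move=> H; have [/existsP[I /and3P[*]]|] :=
  boolP [exists I : {set V}, [&& I \subset X, indep I & 0 <= F I]]; first by exists I.
rewrite negb_exists => /forallP nI; exfalso.
move: H; apply/negP; rewrite -ltNge /hcsum (bigD1 set0) /=; last by rewrite sub0set indep0.
have lt I : I \subset X -> indep I -> F I < 0.
  by move=> s i; have := nI I; rewrite s i /= ltNge.
rewrite -[ltRHS]addr0 ltr_leD //.
  by rewrite cards0 expr0 mul1r lt ?sub0set ?indep0.
apply: sumr_le0 => I /andP[/andP[s i] _]; rewrite mulr_ge0_le0 ?exprn_ge0 // ltW //.
exact: lt.
Qed.


(** Let y be lam times the number of unblocked neighbors of v.  If y >= 2 kap + 2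
    then on average at least y / 2 - 1 >= kap of them are picked, because
    their neighborhood graph is sparse at scale lam.  Otherwise their partition
    function is at most exp (2 kap + 2), so v itself is picked often enough for the
    factor D to compensate; this is what the last hypothesis expresses. *)
Lemma hcsum_local X v (D kap : R) : v \in X -> lam <= 2^-1 -> 0 <= kap ->
  lam ^+ 2 * (adjpairs (nbhd X v))%:R <= 1 ->
  kap * (lam + expR (2 * kap + 2)) <= D * lam ->
  0 <= hcsum X (fun I => D * (v \in I)%:R + #|I :&: nbhd X v|%:R - kap).
Proof.
move=> vX lam2 kap0 sparse HD.
have kD : kap <= D.
  rewrite -(ler_pM2r lam0); apply: le_trans HD.
  by rewrite ler_wpM2l // lerDl expR_ge0.
have nbX : nbhd X v \subset X :\ v.
  apply/subsetP => w; rewrite !inE => /andP[-> vw]; rewrite andbT.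
  by apply: contraTneq vw => ->; rewrite adjI.
apply: (@le_trans _ _ (hcsum X (fun I => (v \in I)%:R * (D - kap)) +
   hcsum X (fun I => (v \notin I)%:R * (#|I :&: nbhd X v|%:R - kap)))); last first.
  rewrite -hcsumD; apply: hcsum_le => I _ _.
  have := ler0n R #|I :&: nbhd X v|.
  by case: (v \in I) => /=; lra.
rewrite hcsum_pin // hcsum_notin (hcsum_split (fun J => #|J|%:R - kap)) // -hcsumZ -hcsumD.
rewrite -[leLHS](mul0r (Z ((X :\ v) :\: nbhd X v))) -hcsum_cst.
apply: hcsum_le => I _ _; set Y := unblocked _ I.
have YS : Y \subset nbhd X v by apply/subsetP => w; rewrite inE => /andP[].
have EY : lam ^+ 2 * (adjpairs Y)%:R <= 1.
  apply: le_trans sparse; apply: ler_wpM2l; first by rewrite exprn_ge0 // ltW.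
  by rewrite ler_nat adjpairsS.
have -> : hcsum Y (fun J => #|J|%:R - kap) = hcsum Y (fun J => #|J|%:R) - kap * Z Y.
  by rewrite -mulNr -hcsum_cst -hcsumD.
have := hcsum_card_ge Y; have := hcpart_le_expR Y; have := hcpart_gt0 Y.
have : 0 <= hcsum Y (fun J => #|J|%:R).
  by rewrite -[leLHS](mul0r (Z Y)) -hcsum_cst; apply: hcsum_le.
set M := hcsum Y _; move: (Z Y) => z; rewrite natrD.
move: EY; move: (#|Y|%:R : R) (ler0n R #|Y|) ((adjpairs Y)%:R : R) => y y0 e EY M0 z0 zle Mge.
have c : lam * y / 2 - 1 <= lam * (y - lam * (y + e)).
  suff : lam * lam * y <= 2^-1 * lam * y by move: EY; lra.
  by rewrite ler_wpM2r // ler_wpM2r // ltW.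
have [big|small] := leP kap (lam * y / 2 - 1).
  have : kap * z <= M.
    by apply: le_trans Mge; rewrite ler_wpM2r ?(le_trans big) // ltW.
  have : 0 <= lam * (D - kap) by rewrite mulr_ge0 ?subr_ge0 // ltW.
  lra.
have : kap * z <= kap * expR (2 * kap + 2).
  rewrite ler_wpM2l //; apply: le_trans zle _; rewrite ler_expR; lra.
lra.
Qed.

(** Each u in I is counted D times as a vertex and at most D times as a neighbor,
    so summing the local estimate over X yields 2 D |I| >= kap |X| on average. *)
Lemma hc_independent X (D kap : R) : lam <= 2^-1 -> 0 <= kap ->
  {in X, forall v, #|nbhd X v|%:R <= D} ->
  {in X, forall v, lam ^+ 2 * (adjpairs (nbhd X v))%:R <= 1} ->
  kap * (lam + expR (2 * kap + 2)) <= D * lam ->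
  exists I, [/\ I \subset X, indep I & kap * #|X|%:R <= 2 * D * #|I|%:R].
Proof.
move=> lam2 kap0 degD sparse HD.
have : 0 <= \sum_(v in X) hcsum X (fun I => D * (v \in I)%:R + #|I :&: nbhd X v|%:R - kap).
  by apply: sumr_ge0 => v vX; apply: hcsum_local => //; apply: sparse.
rewrite -hcsum_sum => /hcsum_exists [I [IX iI H]].
exists I; split=> //; move: H; rewrite sumrB big_split /= sumr_const -mulr_sumr.
have -> : \sum_(i in X) (i \in I)%:R = #|I|%:R :> R.
  rewrite -sum1_card natr_sum big_mkcond [RHS]big_mkcond /=; apply: eq_bigr => u _.
  by case uI: (u \in I); [rewrite (subsetP IX _ uI) | case: ifP].
have : \sum_(i in X) #|I :&: nbhd X i|%:R <= D * #|I|%:R :> R.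
  have -> : \sum_(i in X) #|I :&: nbhd X i|%:R = \sum_(u in I) #|nbhd X u|%:R :> R.
    rewrite -!natr_sum; congr _%:R.
    under eq_bigr do rewrite -sum1_card big_mkcond.
    under [RHS]eq_bigr do rewrite -sum1_card big_mkcond.
    rewrite exchange_big [RHS]big_mkcond /=; apply: eq_bigr => u _.
    case uI: (u \in I); last by rewrite big1 // => v _; rewrite !inE uI.
    rewrite big_mkcond /=; apply: eq_bigr => v _.
    by rewrite !inE uI (subsetP IX _ uI) (adjC v u) /=; case: (v \in X).
  rewrite mulr_natr -sumr_const; apply: ler_sum => u uI.
  by apply: degD; apply: (subsetP IX).
rewrite mulr_natr; lra.
Qed.

End HardCore.

(** Turan's bound up to a constant, from the mean size of a hard-core set. *)
Lemma sparse_independent (R : realType) X : exists I,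
  [/\ I \subset X, indep I &
    #|X|%:R ^+ 2 <= 4 * #|I|%:R * (#|X|%:R + (adjpairs X)%:R) :> R].
Proof.
have [->|X0] := eqVneq X set0.
  by exists set0; rewrite sub0set indep0 cards0 expr0n /= mulr0 mul0r.
have x0 : 0 < #|X|%:R :> R by rewrite ltr0n card_gt0.
move E : ((adjpairs X)%:R : R) => e; have e0 : 0 <= e by rewrite -E.
set x : R := #|X|%:R in x0 *.
(* This lam maximizes lam (x - lam (x + e)), the lower bound on the mean size. *)
pose lam : R := x / (2 * (x + e)).
have xe : 0 < x + e by lra.
have lam0 : 0 < lam by rewrite divr_gt0 // mulr_gt0.
have lamE : lam * (x + e) = x / 2 by rewrite /lam; field; rewrite gt_eqF.
have : 0 <= hcsum lam X (fun I => #|I|%:R - lam * x / 2).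
  rewrite hcsumD hcsum_cst mulNr subr_ge0; apply: le_trans (hcsum_card_ge lam0 X).
  by rewrite natrD E -/x lamE ler_pM2r ?hcpart_gt0 //; lra.
case/hcsum_exists => // I [IX iI H]; exists I; split=> //.
have : x / 2 * x <= 2 * #|I|%:R * (x + e).
  rewrite -lamE mulrAC ler_pM2r //; lra.
rewrite expr2; lra.
Qed.
End IndependentSets.

(** * Spending colors one at a time *)

Section Coloring.
Variables (V P : finType) (adj : rel V) (L : V -> {set P}).
Hypotheses (adjC : symmetric adj) (adjI : irreflexive adj).
Implicit Types (W I J S X : {set V}) (U : {set P}) (u v : V) (a : P).

Local Notation nbhd := (nbhd adj).
Local Notation indep := (indep adj).
Local Notation adjpairs := (adjpairs adj).
Local Notation ordtri := (ordtri adj).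

Definition colorable_avoiding U W : Prop := exists c : V -> P,
  {in W, forall v, c v \in L v :\: U} /\
  {in W &, forall u v, adj u v -> c u != c v}.

Definition monochromatic U I : Prop :=
  exists2 a, a \notin U & {in I, forall v, a \in L v}.

(** When v comes last, its neighbors in W exclude fewer colors than it has. *)
Lemma color_last U W v : v \in W -> (#|nbhd W v| < #|L v :\: U|)%N ->
  colorable_avoiding U (W :\ v) -> colorable_avoiding U W.
Proof.
move=> vW lt [c [cL cadj]].
have [a aL aN] : exists2 a, a \in L v :\: U & a \notin c @: nbhd W v.
  have : ~~ (L v :\: U \subset c @: nbhd W v).
    apply: contraL lt => /subset_leq_card le; rewrite -leqNgt.
    exact: leq_trans le (leq_imset_card _ _).
  by case/subsetPn => a; exists a.
have nba w : w \in W -> adj v w -> a != c w.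
  move=> wW vw; apply: contraNneq aN => ->; apply: imset_f; by rewrite inE wW.
exists (fun w => if w == v then a else c w); split=> [w wW|u w uW wW].
  by case: eqVneq => [-> //|nw]; apply: cL; rewrite !inE nw.
have [->|nu] := eqVneq u v; have [->|nw] := eqVneq w v; rewrite ?adjI //.
- exact: nba.
- by rewrite adjC eq_sym; apply: nba.
- by apply: cadj; rewrite !inE ?nu ?nw.
Qed.

Lemma color_class U W I a : I \subset W -> indep I -> a \notin U ->
  {in I, forall v, a \in L v} ->
  colorable_avoiding (a |: U) (W :\: I) -> colorable_avoiding U W.
Proof.
move=> IW /indepP iI aU aL [c [cL cadj]].
have ca w : w \in W -> w \notin I -> [/\ c w != a, c w \notin U & c w \in L w].
  move=> wW wI; have := cL w; rewrite !inE wI wW negb_or => /(_ isT).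
  by case/andP=> /andP[].
exists (fun w => if w \in I then a else c w); split=> [w wW|u w uW wW uw].
  case: ifPn => wI; first by rewrite inE aU aL.
  by have [_ h1 h2] := ca w wW wI; rewrite inE h1 h2.
case: ifPn => uI; case: ifPn => wI.
- by have := iI u w uI wI; rewrite uw.
- by rewrite eq_sym; have [] := ca w wW wI.
- by have [] := ca u uW uI.
- by apply: cadj; rewrite // inE ?uI ?wI.
Qed.

Section Real.
Variable R : realType.

(** Greedy coloring with a budget: the invariant is that the number of spent colors
    plus the potential of the uncolored set never exceeds the initial
    potential, so that b unspent colors remain in every list. *)
Lemma potential_coloring (Psi : {set V} -> R) (b : R) : (0 < #|P|)%N ->
  (forall W, 0 <= Psi W) ->
  (forall W S, S \subset W -> Psi S <= Psi W) ->
  (forall U W, W != set0 -> {in W, forall v, b <= #|nbhd W v|%:R} ->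
    {in W, forall v, b <= #|L v :\: U|%:R} ->
    exists I, [/\ I \subset W, indep I, monochromatic U I &
                  Psi (W :\: I) + 1 <= Psi W]) ->
  (forall v, b + Psi setT <= #|L v|%:R) ->
  list_colorable adj L.
Proof.
move=> /card_gt0P [a0 _] Psi0 PsiS step bL.
suff [c [cL cadj]] : colorable_avoiding set0 setT.
  exists c; split=> [v|u v uv]; first by have := cL v; rewrite !inE => /(_ isT).
  by apply: cadj; rewrite ?inE.
suff H n U W : (#|W| < n)%N -> #|U|%:R + Psi W <= Psi setT -> colorable_avoiding U W.
  by apply: H (ltnSn _) _; rewrite cards0 add0r.
elim: n U W => // n IH U W /ltnSE leW budget.
have [->|W0] := eqVneq W set0; first by exists (fun=> a0); split=> ?; rewrite inE.
have many v : b <= #|L v :\: U|%:R.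
  have : #|L v|%:R <= #|L v :\: U|%:R + #|U|%:R :> R.
    rewrite -natrD ler_nat -(cardsID U) addnC leq_add2l.
    exact: subset_leq_card (subsetIr _ _).
  move: budget (bL v) (Psi0 W); lra.
have [/existsP[v /andP[vW lt]]|] := boolP [exists v, (v \in W) && (#|nbhd W v|%:R < b)].
  apply: (color_last vW); first by rewrite -(ltr_nat R) (lt_le_trans lt).
  apply: IH; first by rewrite (leq_trans _ leW) // [X in (_ < X)%N](cardsD1 v) vW.
  apply: le_trans budget; rewrite lerD2l; exact: PsiS (subsetDl _ _).
rewrite negb_exists => /forallP deg.
have [|//|I [IW iI [a aU aL] dec]] := step U W W0.
  by move=> v vW; have := deg v; rewrite vW /= -leNgt.
apply: (color_class IW iI aU aL); apply: IH; last first.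
  by rewrite cardsU1 aU add1n -natr1; move: budget dec; lra.
rewrite (leq_trans _ leW) //; apply: proper_card.
rewrite properEneq subsetDl andbT; apply/negP => /eqP e.
by move: dec; rewrite e; lra.
Qed.

(** Double counting of the incidences between S and the unspent colors. *)
Lemma popular_color U S (b : R) : S != set0 -> 0 < b ->
  {in S, forall v, b <= #|L v :\: U|%:R} ->
  exists2 a, a \notin U & b * #|S|%:R <= #|P|%:R * #|[set v in S | a \in L v]|%:R.
Proof.
move=> S0 b0 many.
pose f a := #|[set v in S | a \in L v :\: U]|.
have tot : (\sum_a f a = \sum_(v in S) #|L v :\: U|)%N.
  under eq_bigr do rewrite /f -sum1_card big_mkcond.
  under [RHS]eq_bigr do rewrite -sum1_card big_mkcond.
  rewrite exchange_big [RHS]big_mkcond /=; apply: eq_bigr => v _.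
  case vS: (v \in S); last by rewrite big1 // => a _; rewrite inE vS.
  by apply: eq_bigr => a _; rewrite inE vS.
have bS : 0 < b * #|S|%:R by rewrite mulr_gt0 // ltr0n card_gt0.
have [/existsP[a Ha]|] := boolP [exists a, b * #|S|%:R <= #|P|%:R * (f a)%:R].
  have fa : (f a > 0)%N.
    by rewrite lt0n; apply: contraTneq Ha => ->; rewrite mulr0 -ltNge.
  exists a.
    by move: fa; rewrite card_gt0 => /set0Pn [v]; rewrite !inE => /and3P[].
  apply: le_trans Ha _; rewrite ler_wpM2l // ler_nat; apply: subset_leq_card.
  by apply/subsetP => v; rewrite !inE => /and3P[-> _ ->].
rewrite negb_exists => /forallP lt; exfalso.
have le : b * #|S|%:R <= \sum_a (f a)%:R.
  rewrite -natr_sum tot natr_sum mulr_natr -sumr_const; exact: ler_sum.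
have [/set0Pn [a _]|e] := boolP ([set: P] != set0); last first.
  move: bS; apply/negP; rewrite -leNgt; apply: le_trans le _.
  rewrite big1 // => a _; move: e; rewrite negbK => /eqP/setP/(_ a); by rewrite !inE.
have P0 : 0 < #|P|%:R :> R by rewrite ltr0n; apply/card_gt0P; exists a.
have : \sum_a #|P|%:R * (f a)%:R < \sum_(a : P) (b * #|S|%:R).
  apply: ltr_sum => [|a' _]; last by rewrite ltNge lt.
  by apply/hasP; exists a; rewrite ?mem_index_enum.
by rewrite -mulr_sumr sumr_const -[ltRHS]mulr_natl ltr_pM2l // ltNge le.
Qed.

(** Markov's inequality for the counting measure on W. *)
Lemma markov_count (f : V -> nat) W (s B : R) : 0 < s ->
  (\sum_(v in W) f v)%:R <= s * B ->
  #|[set v in W | s < (f v)%:R]|%:R <= B.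
Proof.
move=> s0 H; rewrite -(ler_pM2l s0); apply: le_trans H.
rewrite (big_setID [set v in W | s < (f v)%:R]) /= natrD.
rewrite (setIidPr _); last by apply/subsetP => v; rewrite inE => /andP[].
apply: ler_wpDr => //; rewrite mulr_natr -sumr_const natr_sum.
by apply: ler_sum => v; rewrite inE => /andP[_ /ltW].
Qed.

(** One round: U is the set of spent colors and W the set of uncolored vertices.
    The ratio r is the proportion of a set that a popular color reaches. *)
Section Step.
Variables (U : {set P}) (W : {set V}) (b r : R).
Hypotheses (r0 : 0 < r) (b0 : 0 < b) (W0 : W != set0) (rb : r * #|P|%:R <= b).
Hypothesis deg : {in W, forall v, b <= #|nbhd W v|%:R}.
Hypothesis lists : {in W, forall v, b <= #|L v :\: U|%:R}.

Lemma palette_class S : S \subset W -> S != set0 ->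
  exists X, [/\ X \subset S, monochromatic U X & r * #|S|%:R <= #|X|%:R].
Proof.
move=> /subsetP SW S0; have [v vS|a aU H] := popular_color S0 b0 (U := U).
  exact/lists/SW.
exists [set v in S | a \in L v]; split.
- by apply/subsetP => v; rewrite inE => /andP[].
- by exists a => // v; rewrite inE => /andP[].
have P0 : 0 < #|P|%:R :> R by rewrite ltr0n; apply/card_gt0P; exists a.
rewrite -(ler_pM2l P0); apply: le_trans H.
by rewrite mulrA ler_wpM2r // mulrC.
Qed.

Lemma monochromaticS I J : I \subset J -> monochromatic U J -> monochromatic U I.
Proof. by move=> /subsetP s [a aU aL]; exists a => // v /s /aL. Qed.

Lemma sparse_class S : S \subset W -> S != set0 ->
  exists (x : R) I, [/\ I \subset S, indep I, monochromatic U I,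
    r * #|S|%:R <= x & x ^+ 2 <= 4 * #|I|%:R * (x + (adjpairs S)%:R)].
Proof.
move=> SW S0; have [X [XS mX rX]] := palette_class SW S0.
have [I [IX iI H]] := sparse_independent adjC adjI R X.
exists #|X|%:R, I; split=> //; first exact: subset_trans XS.
  exact: monochromaticS mX.
apply: le_trans H _; rewrite ler_wpM2l ?mulr_ge0 // lerD2l ler_nat.
exact: adjpairsS.
Qed.

(** The hard-core bound is applied to the vertices of S that have a popular color
    in their lists; b replaces D in the last hypothesis because b <= D. *)
Lemma hc_class S (lam s D kap : R) : S \subset W -> #|W|%:R <= 2 * #|S|%:R :> R ->
  {in S, forall v, #|nbhd W v|%:R <= D} -> {in S, forall v, (adjpairs (nbhd W v))%:R <= s} ->
  0 < lam -> lam <= 2^-1 -> lam ^+ 2 * s <= 1 -> 0 <= kap ->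
  kap * (lam + expR (2 * kap + 2)) <= b * lam ->
  exists I, [/\ I \subset W, indep I, monochromatic U I &
    kap * r * #|W|%:R <= 4 * D * #|I|%:R].
Proof.
move=> SW bigS degS ordtriS lam0 lam2 lams kap0 Hk.
have S0 : S != set0.
  apply: contraTneq bigS => ->; rewrite cards0 mulr0 -ltNge ltr0n card_gt0 //.
have [X [XS mX rX]] := palette_class SW S0.
have bD : b <= D.
  case/set0Pn: S0 => v vS; apply: le_trans (degS v vS); apply: deg.
  exact: (subsetP SW).
have sX v : nbhd X v \subset nbhd W v by apply: nbhdS; apply: subset_trans SW.
have [|||I [IX iI H]] := @hc_independent V adj adjC adjI R lam lam0 X D kap lam2 kap0.
- move=> v /(subsetP XS) vS; apply: le_trans (degS v vS); rewrite ler_nat.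
  exact: subset_leq_card.
- move=> v /(subsetP XS) vS; apply: le_trans lams; apply: ler_wpM2l.
    by rewrite exprn_ge0 // ltW.
  by apply: le_trans (ordtriS v vS); rewrite ler_nat adjpairsS.
- by apply: le_trans Hk _; rewrite ler_pM2r.
exists I; split=> //; first exact: subset_trans IX (subset_trans XS SW).
  exact: monochromaticS mX.
have : kap * r * #|W|%:R <= 2 * (kap * #|X|%:R).
  apply: (@le_trans _ _ (kap * r * (2 * #|S|%:R))).
    by rewrite ler_wpM2l // mulr_ge0 // ltW.
  by have := ler_wpM2l kap0 rX; lra.
lra.
Qed.

Lemma sparse_size (x i e : R) : 0 < x -> x ^+ 2 <= 4 * i * (x + e) -> 0 <= i -> e <= x ->
  x <= 8 * i.
Proof.
move=> x0 H i0 ex; rewrite -(ler_pM2r x0) -expr2; apply: le_trans H _.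
have -> : 8 * i * x = 4 * i * (x + x) by ring.
by rewrite ler_wpM2l ?mulr_ge0 // lerD2l.
Qed.

Lemma nbhd_class (v : V) (D : R) : v \in W -> 0 < D -> D <= #|nbhd W v|%:R ->
  exists (x : R) I, [/\ I \subset nbhd W v, indep I, monochromatic U I,
    r * D <= x & x ^+ 2 <= 4 * #|I|%:R * (x + (adjpairs (nbhd W v))%:R)].
Proof.
move=> vW D0 HD.
have nbW : nbhd W v \subset W by apply/subsetP => w; rewrite inE => /andP[].
have [|x [I [Inb iI mI rx H]]] := sparse_class nbW.
  by rewrite -card_gt0 -(ltr0n R); apply: lt_le_trans HD.
exists x, I; split=> //; apply: le_trans rx; by rewrite ler_pM2l.
Qed.

(** With v in the fewest triangles, either its neighborhood is sparse enough for
    a large class, or every vertex of the class carries at least as many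
    triangles as v does: the smaller the class, the more triangles per vertex. *)
Lemma small_step : exists I, [/\ I \subset W, indep I, monochromatic U I &
  r * b <= 8 * #|I|%:R \/ (ordtri (W :\: I))%:R + (r * b) ^+ 2 / 8 <= (ordtri W)%:R].
Proof.
have [v vW vmin] := exists_minimizer (fun v => adjpairs (nbhd W v)) W0.
have [x [I [Inb iI mI rx H]]] := nbhd_class vW b0 (deg vW).
have IW : I \subset W.
  by apply: subset_trans Inb _; apply/subsetP => w; rewrite inE => /andP[].
have rb0 : 0 < r * b by rewrite mulr_gt0.
have x0 : 0 < x by apply: lt_le_trans rx.
exists I; split=> //; have [le|lt] := leP (adjpairs (nbhd W v))%:R x.
  by left; apply: le_trans rx _; apply: sparse_size H _ _.
right; have : (ordtri (W :\: I) + #|I| * adjpairs (nbhd W v) <= ordtri W)%N.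
  apply: leq_trans (ordtri_setD adj IW); rewrite leq_add2l -sum_nat_const.
  by apply: leq_sum => u uI; apply: vmin; apply: (subsetP IW).
rewrite -(ler_nat R) natrD natrM.
have : (r * b) ^+ 2 <= x ^+ 2 by rewrite ler_sqr ?nnegrE // ltW.
move: lt H; set e := (adjpairs _)%:R; set i := #|I|%:R => lt H.
have : i * (x + e) <= i * (2 * e) by rewrite ler_wpM2l //; lra.
lra.
Qed.

Section Dense.
Variables (lam s kap : R).
Hypotheses (lam0 : 0 < lam) (lam2 : lam <= 2^-1) (lams : lam ^+ 2 * s <= 1).
Hypotheses (kap0 : 0 <= kap) (Hk : kap * (lam + expR (2 * kap + 2)) <= b * lam).
Hypotheses (s0 : 0 < s) (fewtri : (ordtri W)%:R <= s * (#|W|%:R / 4)).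

(* The vertices in too many triangles, at most a quarter of W by Markov. *)
Let bad := [set v in W | s < (adjpairs (nbhd W v))%:R].

Let bad_small : #|bad|%:R <= #|W|%:R / 4 :> R.
Proof. exact: markov_count. Qed.

(** Either some vertex of degree above D has a sparse neighborhood, or D bounds the
    degrees outside the bad vertices. *)
Lemma middle_step (D : R) : 0 < D -> s <= r * D ->
  exists I, [/\ I \subset W, indep I, monochromatic U I &
    r * D <= 8 * #|I|%:R \/ kap * r * #|W|%:R <= 4 * D * #|I|%:R].
Proof.
move=> D0 sD.
have bW : bad \subset W by apply/subsetP => w; rewrite inE => /andP[].
have [/existsP[v /andP[]]|] := boolP [exists v, (v \in W :\: bad) && (D < #|nbhd W v|%:R)].
  rewrite !inE => /andP[+ vW] /ltW HD; rewrite vW /= -leNgt => es.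
  have [x [I [Inb iI mI rx H]]] := nbhd_class vW D0 HD.
  exists I; split=> //.
    by apply: subset_trans Inb _; apply/subsetP => w; rewrite inE => /andP[].
  left; apply: (le_trans rx); apply: sparse_size H _ _ => //.
    by apply: lt_le_trans rx; rewrite mulr_gt0.
  exact: le_trans es (le_trans sD rx).
rewrite negb_exists => /forallP nov.
have [|||v|I [IW iI mI H]] :=
  @hc_class (W :\: bad) lam s D kap _ _ _ _ lam0 lam2 lams kap0 Hk.
- exact: subsetDl.
- have : #|W|%:R = #|bad|%:R + #|W :\: bad|%:R :> R.
    by rewrite -natrD -(cardsID bad W) (setIidPr bW).
  move: bad_small; have := ler0n R #|W|; lra.
- by move=> v vW; have := nov v; rewrite vW /= -leNgt.
- by rewrite !inE => /andP[+ vW]; rewrite vW /= -leNgt.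
by exists I; split=> //; right.
Qed.

Lemma large_step (D : R) : 0 < D -> (adjpairs W)%:R <= D * (#|W|%:R / 4) ->
  exists I, [/\ I \subset W, indep I, monochromatic U I &
    kap * r * #|W|%:R <= 4 * D * #|I|%:R].
Proof.
move=> D0 few; pose bad2 := [set v in W | D < #|nbhd W v|%:R].
have bad2_small : #|bad2|%:R <= #|W|%:R / 4 :> R by exact: markov_count.
have bW : bad :|: bad2 \subset W.
  by apply/subsetP => w; rewrite !inE => /orP[] /andP[].
have [|||v|I [IW iI mI H]] :=
  @hc_class (W :\: (bad :|: bad2)) lam s D kap _ _ _ _ lam0 lam2 lams kap0 Hk.
- exact: subsetDl.
- have : #|W|%:R = #|bad :|: bad2|%:R + #|W :\: (bad :|: bad2)|%:R :> R.
    by rewrite -natrD -(cardsID (bad :|: bad2) W) (setIidPr bW).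
  have : #|bad :|: bad2|%:R <= #|bad|%:R + #|bad2|%:R :> R.
    by rewrite -natrD ler_nat cardsU leq_subr.
  move: bad_small bad2_small; lra.
- move=> v; rewrite !inE => /andP[+ vW]; rewrite vW /= negb_or => /andP[_].
  by rewrite -leNgt.
- by rewrite !inE => /andP[+ vW]; rewrite vW /= negb_or => /andP[+ _]; rewrite -leNgt.
by exists I.
Qed.
End Dense.
End Step.
End Real.
End Coloring.

(** * Ordered counts versus sets of edges and triangles *)

Section Counting.
Variables (V : finType) (adj : rel V).
Hypotheses (adjC : symmetric adj) (adjI : irreflexive adj).

Lemma card_sum_mem (S : {set V}) : (\sum_u (u \in S) = #|S|)%N.
Proof. by rewrite -sum1_card [RHS]big_mkcond. Qed.

Lemma adjpairs_edges : (adjpairs adj setT <= 4 * #|edges adj|)%N.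
Proof.
have -> : (adjpairs adj setT = \sum_u \sum_v adj u v)%N.
  apply: eq_big => [u|u _]; first by rewrite inE.
  by rewrite -card_sum_mem; apply: eq_bigr => v _; rewrite !inE.
apply: (@leq_trans (\sum_u \sum_v \sum_(S in edges adj) (u \in S) * (v \in S))).
  apply: leq_sum => u _; apply: leq_sum => v _; case uv: (adj u v) => //.
  rewrite (bigD1 [set u; v]) /=; first by rewrite !inE !eqxx orbT.
  by apply/imsetP; exists (u, v); rewrite ?inE.
under eq_bigr do rewrite exchange_big.
rewrite exchange_big mulnC -sum_nat_const; apply: leq_sum => S /imsetP [[u v] _ ->].
under eq_bigr do rewrite -big_distrr /=.
rewrite -big_distrl /= card_sum_mem cards2.
by case: eqP.
Qed.

Lemma ordtri_triangles : (ordtri adj setT <= 27 * #|triangles adj|)%N.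
Proof.
have -> : (ordtri adj setT = \sum_u \sum_v \sum_w [&& adj u v, adj u w & adj v w])%N.
  apply: eq_big => [u|u _]; first by rewrite inE.
  rewrite /adjpairs big_mkcond /=; apply: eq_bigr => v _; rewrite !inE /=.
  case: (adj u v) => /=; last by rewrite big1.
  by rewrite -card_sum_mem; apply: eq_bigr => w _; rewrite !inE.
apply: (@leq_trans (\sum_u \sum_v \sum_w \sum_(S in triangles adj)
    (u \in S) * ((v \in S) * (w \in S)))).
  apply: leq_sum => u _; apply: leq_sum => v _; apply: leq_sum => w _.
  have [/and3P[uv uw vw]|//] := boolP [&& _, _ & _].
  have ne x y : adj x y -> x != y by apply: contraTneq => ->; rewrite adjI.
  rewrite (bigD1 [set u; v; w]) /=; first by rewrite !inE !eqxx !orbT.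
  rewrite inE; apply/andP; split.
    by rewrite setUC cardsU1 cards2 !inE ne // negb_or ![w == _]eq_sym !ne.
  apply/forall_inP => x; rewrite !inE => /orP[/orP[]|] /eqP->;
  apply/forall_inP => y; rewrite !inE => /orP[/orP[]|] /eqP->;
  by rewrite ?eqxx // ?uv ?uw ?vw 1?adjC ?uv ?uw ?vw implybT.
under eq_bigr => u _ do under eq_bigr => v _ do rewrite exchange_big.
under eq_bigr => u _ do rewrite exchange_big.
rewrite exchange_big mulnC -sum_nat_const; apply: leq_sum => S.
rewrite inE => /andP[/eqP S3 _].
under eq_bigr => u _ do under eq_bigr => v _ do rewrite -!big_distrr /= card_sum_mem S3.
under eq_bigr => u _ do rewrite -big_distrr -big_distrl /= card_sum_mem S3.
by rewrite -big_distrl /= card_sum_mem S3.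
Qed.

Lemma edges_nonisolated : (#|edges adj| <= #|nonisolated adj| ^ 2)%N.
Proof.
apply: leq_trans (leq_imset_card _ _) _; rewrite -mulnn -cardsX.
apply: subset_leq_card; apply/subsetP => -[u v]; rewrite !inE => uv.
by apply/andP; split; apply/existsP; [exists v | exists u; rewrite adjC].
Qed.
End Counting.

(** * Counting the rounds *)

(* Positivity of products, quotients and powers, closing atoms before any
   unfolding can happen. *)
Ltac positivity := repeat first
  [ assumption | by rewrite ltr0n | apply: divr_gt0 | apply: exprn_gt0 | apply: mulr_gt0 ].

Section Core.
Variables (R : realType) (rho eps ell : R) (p : nat).
Let q : R := p%:R.
(* The thresholds are n = N2 = eta q^2 and n = N1 = sig^2 q^2 ell; eta, sig and the
   bounds eps1, eps3 make each of the four terms of the potential at most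
   rho q / 8, so that their sum fits in the budget rho q / 2, and eps2 leaves
   at most q / 4 ordered triangles per vertex of W as long as n >= N2. *)
Let eta := rho ^+ 3 / 256.
Let sig := rho ^+ 2 / 1536.
Hypotheses (rho0 : 0 < rho) (eps0 : 0 < eps).
Hypotheses (eps1 : eps <= rho ^+ 5 / 1024) (eps2 : eps <= eta / 4)
  (eps3 : eps <= sig ^+ 2 * rho ^+ 2 / 12288).
Hypotheses (ell1 : 12 + 8 / rho <= ell) (ell2 : 4 / (rho ^+ 2 * eta) <= ell).
Hypothesis (pE : q = expR ell).
Variables (V P : finType) (adj : rel V) (L : V -> {set P}).
Hypotheses (adjC : symmetric adj) (adjI : irreflexive adj).
Hypotheses (cardP : #|P| = p) (bigL : forall v, rho * q <= #|L v|%:R).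
Hypotheses (few_edges : (adjpairs adj setT)%:R <= eps * q ^+ 3 * ell ^+ 2)
  (few_triangles : (ordtri adj setT)%:R <= eps * q ^+ 3).

Let q0 : 0 < q. Proof. by rewrite pE expR_gt0. Qed.
Let ell12 : 12 <= ell.
Proof. apply: le_trans ell1; by rewrite lerDl divr_ge0 // ltW. Qed.
Let ell0 : 0 < ell. Proof. by apply: lt_le_trans ell12. Qed.
Let eta0 : 0 < eta. Proof. by rewrite divr_gt0 // exprn_gt0. Qed.
Let sig0 : 0 < sig. Proof. by rewrite divr_gt0 // exprn_gt0. Qed.

Let b := rho * q / 2.
Let r := rho / 2.
Let N1 := sig ^+ 2 * q ^+ 2 * ell.
Let N2 := eta * q ^+ 2.
Let lam := expR (- (ell / 2)).
Let kap := ell / 12.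

Let N10 : 0 < N1.
Proof. by apply: mulr_gt0 => //; apply: mulr_gt0; apply: exprn_gt0. Qed.
Let N20 : 0 < N2. Proof. by apply: mulr_gt0 => //; apply: exprn_gt0. Qed.

Let lam_sq : lam ^+ 2 * q = 1.
Proof.
rewrite pE expr2 -!expRD -[RHS]expR0; congr expR; lra.
Qed.

Let lam_half : lam <= 2^-1.
Proof.
rewrite /lam expRN lef_pV2 ?posrE ?expR_gt0 //.
apply: le_trans (expR_ge1Dx _); move: ell12; lra.
Qed.

(* Since kap = ell / 12, the left side is of order at most exp (3 kap) = q^(1/4),
   while the right side is of order q^(1/2). *)
Let kap_lam : kap * (lam + expR (2 * kap + 2)) <= b * lam.
Proof.
have -> : b * lam = rho / 2 * expR (ell / 2).
  rewrite /b /lam pE -mulrA mulrAC -!mulrA -expRD; congr (_ * (_ * expR _)); lra.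
have k1 : kap <= expR kap by apply: le_trans (expR_ge1Dx _); rewrite lerDr.
have k0 : 0 < kap by rewrite divr_gt0.
have y1 : 1 <= expR (2 * kap + 2) by apply: le_trans (expR_ge1Dx _); lra.
have e2 : 2 <= expR 1 :> R by apply: le_trans (expR_ge1Dx _); lra.
have y2 : lam + expR (2 * kap + 2) <= expR (2 * kap + 3).
  have -> : 2 * kap + 3 = (2 * kap + 2) + 1 by ring.
  rewrite [leRHS]expRD.
  have : expR (2 * kap + 2) * 2 <= expR (2 * kap + 2) * expR 1.
    by rewrite ler_wpM2l ?expR_ge0.
  move: lam_half y1; lra.
apply: (@le_trans _ _ (expR kap * expR (2 * kap + 3))).
  by apply: ler_pM => //; rewrite ?addr_ge0 ?expR_ge0 // ltW.
rewrite -expRD.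
have -> : ell / 2 = kap + (2 * kap + 3) + (ell / 4 - 3) by rewrite /kap; lra.
rewrite [X in _ <= _ * X]expRD [leRHS]mulrCA ler_pMr ?expR_gt0 //.
have : 2 / rho <= expR (ell / 4 - 3).
  apply: le_trans (expR_ge1Dx _); move: ell1.
  have -> : 8 / rho = 4 * (2 / rho) by ring.
  lra.
rewrite ler_pdivrMr //; lra.
Qed.

(* The term psi1 pays for the rounds with n >= N1, psi2 for N2 <= n <= N1, and
   psi3, psi4 for n <= N2, according to whether vertices or triangles are
   removed.  Up to a constant factor psi1 is 1 / N1 - 1 / (x + N1), and N1 is
   added to x to keep it bounded; psi2 and psi3 are cut off for the same reason.  All terms are
   monotone, so only the one in charge of a round has to be seen to drop. *)
Let psi1 x := 1536 * eps * q / (sig ^+ 2 * rho) * (x / (x + N1)).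
Let psi2 x := 192 / (rho * ell) * Num.sqrt (Num.min x N1 * ell).
Let psi3 x := 32 / (rho ^+ 2 * q) * Num.min x N2.
Let psi4 x := 128 / (rho ^+ 4 * q ^+ 2) * x.
Let Psi (W : {set V}) : R :=
  psi1 #|W|%:R + psi2 #|W|%:R + psi3 #|W|%:R + psi4 (ordtri adj W)%:R.

Let c1 : 0 < 1536 * eps * q / (sig ^+ 2 * rho).
Proof. by positivity. Qed.
Let c2 : 0 < 192 / (rho * ell).
Proof. by positivity. Qed.
Let c3 : 0 < 32 / (rho ^+ 2 * q).
Proof. by positivity. Qed.
Let c4 : 0 < 128 / (rho ^+ 4 * q ^+ 2).
Proof. by positivity. Qed.

Let frac_diff x g : 0 <= x - g -> 0 <= x ->
  x / (x + N1) - (x - g) / (x - g + N1) = N1 * g / ((x + N1) * (x - g + N1)).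
Proof. by move=> H1 H2; field; rewrite !gt_eqF // ltr_wpDl. Qed.

Let psi1S x y : 0 <= x -> x <= y -> psi1 x <= psi1 y.
Proof.
move=> x0 xy; rewrite ler_pM2l // -subr_ge0.
have -> : x = y - (y - x) by ring.
have y0 := le_trans x0 xy.
have N1ge := ltW N10.
rewrite frac_diff ?subKr //; apply: divr_ge0; apply: mulr_ge0 => //;
  by [rewrite subr_ge0 | apply: addr_ge0].
Qed.

Let psi2S x y : x <= y -> psi2 x <= psi2 y.
Proof.
move=> xy; rewrite ler_pM2l // ler_wsqrtr // ler_pM2r //.
by rewrite le_min2.
Qed.

Let psi3S x y : x <= y -> psi3 x <= psi3 y.
Proof. by move=> xy; rewrite ler_pM2l // le_min2. Qed.

Let psi4S x y : x <= y -> psi4 x <= psi4 y.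
Proof. by move=> xy; rewrite ler_pM2l. Qed.

Let PsiS (W S : {set V}) : S \subset W -> Psi S <= Psi W.
Proof.
move=> s; have le : #|S|%:R <= #|W|%:R :> R by rewrite ler_nat subset_leq_card.
by rewrite !lerD ?psi1S ?psi2S ?psi3S ?psi4S // ler_nat ordtriS.
Qed.

Let Psi0 (W : {set V}) : 0 <= Psi W.
Proof.
rewrite !addr_ge0 // mulr_ge0 ?(ltW c1) ?(ltW c2) ?(ltW c3) ?(ltW c4) //.
- by rewrite divr_ge0 // addr_ge0 // ltW.
- exact: sqrtr_ge0.
- by rewrite le_min ler0n ltW.
Qed.

Let PsiT : Psi setT <= rho * q / 2.
Proof.
have h1 : psi1 #|[set: V]|%:R <= rho * q / 8.
  apply: (@le_trans _ _ (1536 * eps * q / (sig ^+ 2 * rho) * 1)).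
    rewrite ler_pM2l // ler_pdivrMr ?mul1r ?lerDl ?(ltW N10) //.
    by rewrite ltr_wpDl.
  rewrite mulr1 ler_pdivrMr; last by positivity.
  have : eps * (1536 * q) <= (sig ^+ 2 * rho ^+ 2 / 12288) * (1536 * q).
    by rewrite ler_wpM2r // mulr_ge0 // ltW.
  rewrite expr2; lra.
have h2 : psi2 #|[set: V]|%:R <= rho * q / 8.
  apply: (@le_trans _ _ (192 / (rho * ell) * (sig * q * ell))).
    rewrite ler_pM2l // -[leRHS]ger0_norm; last by apply: ltW; positivity.
    rewrite -sqrtr_sqr ler_wsqrtr //.
    have -> : (sig * q * ell) ^+ 2 = N1 * ell by rewrite /N1; ring.
    by rewrite ler_pM2r // ge_min lexx orbT.
  rewrite le_eqVlt; apply/orP; left; apply/eqP; rewrite /sig; field.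
  by rewrite !gt_eqF.
have h3 : psi3 #|[set: V]|%:R <= rho * q / 8.
  apply: (@le_trans _ _ (32 / (rho ^+ 2 * q) * N2)).
    by rewrite ler_pM2l // ge_min lexx orbT.
  rewrite le_eqVlt; apply/orP; left; apply/eqP; rewrite /N2 /eta; field.
  by rewrite !gt_eqF.
have h4 : psi4 (ordtri adj setT)%:R <= rho * q / 8.
  apply: (@le_trans _ _ (128 / (rho ^+ 4 * q ^+ 2) * (rho ^+ 5 / 1024 * q ^+ 3))).
    rewrite ler_pM2l //; apply: le_trans few_triangles _.
    by rewrite ler_wpM2r // exprn_ge0 // ltW.
  rewrite le_eqVlt; apply/orP; left; apply/eqP; field.
  by rewrite !gt_eqF.
rewrite /Psi; lra.
Qed.

Let rb : r * #|P|%:R <= b.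
Proof. by rewrite cardP /r /b /q; lra. Qed.

Section Step.
Variables (U : {set P}) (W : {set V}).
Hypotheses (W0 : W != set0) (deg : {in W, forall v, b <= #|nbhd adj W v|%:R}).
Hypothesis lists : {in W, forall v, b <= #|L v :\: U|%:R}.
Let n : R := #|W|%:R.
Let r0 : 0 < r. Proof. by rewrite divr_gt0. Qed.
Let b0 : 0 < b. Proof. by rewrite divr_gt0 // mulr_gt0. Qed.
Let n0 : 0 < n. Proof. by rewrite ltr0n card_gt0. Qed.

Let nD (I : {set V}) : I \subset W -> #|W :\: I|%:R = n - #|I|%:R.
Proof.
move=> s; rewrite /n -(cardsID I W) (setIidPr s) natrD; ring.
Qed.

Let progress := exists I : {set V}, [/\ I \subset W, indep adj I, monochromatic L U I &
                  Psi (W :\: I) + 1 <= Psi W].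

Let le4 (I : {set V}) :
  [/\ psi1 #|W :\: I|%:R <= psi1 n, psi2 #|W :\: I|%:R <= psi2 n,
      psi3 #|W :\: I|%:R <= psi3 n &
      psi4 (ordtri adj (W :\: I))%:R <= psi4 (ordtri adj W)%:R].
Proof.
have le : #|W :\: I|%:R <= n by rewrite ler_nat subset_leq_card // subsetDl.
by rewrite psi1S ?psi2S ?psi3S ?psi4S // ler_nat ordtriS // subsetDl.
Qed.

Let step_small : n <= N2 -> progress.
Proof.
move=> nN2.
have [I [IW iI mI H]] := small_step adjC adjI r0 b0 W0 rb deg lists.
exists I; split=> //; have [l1 l2 l3 l4] := le4 I.
have rbE : r * b = rho ^+ 2 * q / 4 by rewrite /r /b; field.
rewrite rbE in H.
suff : psi3 #|W :\: I|%:R + 1 <= psi3 n \/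
       psi4 (ordtri adj (W :\: I))%:R + 1 <= psi4 (ordtri adj W)%:R.
  rewrite /Psi -/n; case=> ?; lra.
case: H => H; [left|right].
  rewrite /psi3 nD // !min_l //; last first.
    by apply: le_trans nN2; rewrite lerBlDr lerDl.
  rewrite mulrBr; set c := 32 / _.
  suff : c * (rho ^+ 2 * q / 4 / 8) <= c * #|I|%:R.
    have -> : c * (rho ^+ 2 * q / 4 / 8) = 1 by rewrite /c; field; rewrite !gt_eqF.
    lra.
  by rewrite (ler_pM2l c3); move: H; lra.
rewrite /psi4; set c := 128 / _.
have e : c * ((rho ^+ 2 * q / 4) ^+ 2 / 8) = 1 by rewrite /c; field; rewrite !gt_eqF.
by move: H; rewrite -(ler_pM2l c4) mulrDr -/c e.
Qed.

Let fewtri : N2 <= n -> (ordtri adj W)%:R <= q * (n / 4).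
Proof.
move=> nN2; apply: le_trans (_ : (ordtri adj setT)%:R <= _).
  by rewrite ler_nat ordtriS.
apply: le_trans few_triangles _; apply: (@le_trans _ _ (q * (N2 / 4))).
  have -> : q * (N2 / 4) = eta / 4 * q ^+ 3 by rewrite /N2; field.
  by rewrite ler_wpM2r // exprn_ge0 // ltW.
rewrite ler_pM2l //; lra.
Qed.

Let lam0 : 0 < lam. Proof. exact: expR_gt0. Qed.
Let kap0 : 0 <= kap. Proof. by rewrite divr_ge0 // ltW. Qed.

Let step_middle : N2 <= n -> n <= N1 -> progress.
Proof.
move=> nN2 nN1; set D := Num.sqrt (n * ell).
have DE : D * D = n * ell by rewrite -expr2 sqr_sqrtr // mulr_ge0 // ltW.
have D0 : 0 < D by rewrite sqrtr_gt0 mulr_gt0.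
have qD : q <= r * D.
  rewrite -(@ler_sqr _ q) ?nnegrE ?(ltW q0) //; last by rewrite mulr_ge0 ?ltW.
  rewrite exprMn [D ^+ 2]expr2 DE.
  apply: (@le_trans _ _ (r ^+ 2 * (N2 * (4 / (rho ^+ 2 * eta))))).
    rewrite le_eqVlt; apply/orP; left; apply/eqP; rewrite /r /N2; field.
    by rewrite !gt_eqF.
  rewrite ler_pM2l ?exprn_gt0 //; apply: ler_pM => //; first exact: ltW.
  by apply: ltW; positivity.
have lams : lam ^+ 2 * q <= 1 by rewrite lam_sq.
have [I [IW iI mI H]] := middle_step adjC adjI r0 b0 W0 rb deg lists lam0 lam_half
  lams kap0 kap_lam q0 (fewtri nN2) D0 qD.
exists I; split=> //; have [l1 l2 l3 l4] := le4 I.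
have Ibig : rho * D <= 96 * #|I|%:R.
  case: H => H.
    apply: (@le_trans _ _ (12 * (r * D))); last by lra.
    have : 0 < rho * D by rewrite mulr_gt0.
    rewrite /r; lra.
  rewrite -(ler_pM2l D0).
  have -> : D * (rho * D) = 24 * (kap * r * n) by rewrite mulrCA DE /kap /r; field.
  by move: H; rewrite -/n; lra.
suff : psi2 #|W :\: I|%:R + 1 <= psi2 n by rewrite /Psi -/n; lra.
have n'n : n - #|I|%:R <= n by rewrite lerBlDr lerDl.
have n'0 : 0 <= n - #|I|%:R by rewrite -nD.
rewrite /psi2 nD // !min_l //; last exact: le_trans nN1.
rewrite -/D; set D' := Num.sqrt _.
have D'E : D' * D' = (n - #|I|%:R) * ell by rewrite -expr2 sqr_sqrtr // mulr_ge0 // ltW.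
have D'0 : 0 <= D' by exact: sqrtr_ge0.
have D'D : D' <= D by rewrite ler_wsqrtr // ler_pM2r.
set c := 192 / _.
have dec : rho * ell / 192 <= D - D'.
  rewrite -(ler_pM2r (_ : 0 < 192 * D)); last by rewrite mulr_gt0.
  apply: (@le_trans _ _ (96 * (#|I|%:R * ell))).
    have := ler_wpM2r (ltW ell0) Ibig; lra.
  have -> : #|I|%:R * ell = D * D - D' * D' by rewrite DE D'E; ring.
  have : 0 <= (D - D') * (D - D') by rewrite mulr_ge0 ?subr_ge0.
  lra.
have e : c * (rho * ell / 192) = 1 by rewrite /c; field; rewrite !gt_eqF.
by move: dec; rewrite -(ler_pM2l c2) -/c e; lra.
Qed.

Let step_large : N2 <= n -> N1 <= n -> progress.
Proof.
move=> nN2 nN1; set Q := eps * q ^+ 3 * ell ^+ 2.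
have Q0 : 0 < Q by rewrite ?(mulr_gt0, exprn_gt0).
pose D := 4 * Q / n.
have D0 : 0 < D by rewrite divr_gt0 // mulr_gt0.
have few : (adjpairs adj W)%:R <= D * (n / 4).
  have -> : D * (n / 4) = Q by rewrite /D; field; rewrite gt_eqF.
  by apply: le_trans few_edges; rewrite ler_nat adjpairsS.
have lams : lam ^+ 2 * q <= 1 by rewrite lam_sq.
have [I [IW iI mI H]] := large_step adjC adjI r0 b0 W0 rb deg lists lam0 lam_half
  lams kap0 kap_lam q0 (fewtri nN2) D0 few.
exists I; split=> //; have [l1 l2 l3 l4] := le4 I.
suff : psi1 #|W :\: I|%:R + 1 <= psi1 n by rewrite /Psi -/n; lra.
have n'n : n - #|I|%:R <= n by rewrite lerBlDr lerDl.
have n'0 : 0 <= n - #|I|%:R by rewrite -nD.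
have Ibig : rho * n ^+ 2 <= 384 * (eps * q ^+ 3 * ell) * #|I|%:R.
  rewrite -(ler_pM2r ell0).
  have -> : rho * n ^+ 2 * ell = 24 * (n * (kap * r * n)) by rewrite /kap /r; field.
  have -> : 384 * (eps * q ^+ 3 * ell) * #|I|%:R * ell = 24 * (n * (4 * D * #|I|%:R)).
    by rewrite /D /Q; field; rewrite gt_eqF.
  by rewrite ler_pM2l // ler_pM2l.
rewrite /psi1 nD // -lerBrDl -mulrBr frac_diff //.
set c := 1536 * eps * q / _.
have e : c * (N1 * (rho / (384 * (eps * q ^+ 3 * ell))) / 4) = 1.
  by rewrite /c /N1; field; rewrite !gt_eqF.
rewrite -[leLHS]e (ler_pM2l c1) -[leLHS]mulrA -[leRHS]mulrA ler_pM2l //.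
have a0 : 0 < n + N1 by exact: addr_gt0.
have a1 : 0 < n - #|I|%:R + N1 by exact: ltr_wpDl.
rewrite ler_pdivlMr; last exact: mulr_gt0.
apply: (@le_trans _ _ (rho / (384 * (eps * q ^+ 3 * ell)) / 4 * ((2 * n) * (2 * n)))).
  apply: ler_wpM2l; first by apply: ltW; positivity.
  by apply: ler_pM; rewrite ?(ltW a0) ?(ltW a1) //; move: nN1 n'n; lra.
have e0 : 0 < 384 * (eps * q ^+ 3 * ell) by positivity.
rewrite -(ler_pM2l e0); apply: le_trans Ibig.
rewrite le_eqVlt; apply/orP; left; apply/eqP; field.
by rewrite !gt_eqF.
Qed.

Lemma potential_drops : progress.
Proof.
have [|/ltW nN2] := leP n N2; first exact: step_small.
by have [|/ltW] := leP n N1; [exact: step_middle | exact: step_large].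
Qed.
End Step.

(** The statement in polynomial form: the budget for Psi is b, and every list has
    at least 2 b colors. *)
Lemma sparse_list_colorable : list_colorable adj L.
Proof.
apply: (@potential_coloring V P adj L adjC adjI R Psi b) => //.
- by rewrite cardP -(ltr_nat R).
- exact: potential_drops.
- move=> v; apply: le_trans (bigL v); move: PsiT; rewrite /b; lra.
Qed.
End Core.

(** * From the logarithmic hypothesis to polynomial bounds *)

Section Rescaling.
Variable R : realType.

Lemma powR_cube (a x : R) (k : nat) : 0 <= a -> x * 3 = k%:R -> (a `^ x) ^+ 3 = a ^+ k.
Proof. by move=> a0 e; rewrite -powR_mulrn ?powR_ge0 // -powRrM e powR_mulrn. Qed.

Lemma Log_ge1 (x : R) : 1 <= Log x.
Proof. by rewrite /Log le_max lexx. Qed.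

Lemma Log_le_power (m n q A : R) : 0 < A -> 1 <= ln q -> 0 < q ->
  0 <= n -> m <= n ^+ 2 -> n <= q `^ A -> Log m <= (2 * A + 1) * ln q.
Proof.
move=> A0 l1 q0 n0 mn nq.
have Al : 0 <= A * ln q by rewrite mulr_ge0 ?(ltW A0) ?(le_trans ler01).
rewrite /Log ge_max; apply/andP; split; first by lra.
have [m1|m1] := leP m 1; first by rewrite ln1; lra.
apply: (@le_trans _ _ (ln ((q `^ A) ^+ 2))); last first.
  rewrite lnXn ?powR_gt0 // ln_powR -mulr_natr; lra.
have m0 : 0 < m by apply: lt_trans m1.
rewrite ler_ln ?posrE ?exprn_gt0 ?powR_gt0 //.
by apply: le_trans mn _; rewrite ler_sqr ?nnegrE ?powR_ge0.
Qed.

Lemma cube_bounds (K m t q : R) : 0 < K -> 0 <= m -> 0 <= t ->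
  K * (m `^ (1 / 3) / (Log m) `^ (2 / 3) + t `^ (1 / 3)) <= q ->
  K ^+ 3 * m <= q ^+ 3 * Log m ^+ 2 /\ K ^+ 3 * t <= q ^+ 3.
Proof.
move=> K0 m0 t0 H; have Lm : 0 < Log m by apply: lt_le_trans (Log_ge1 m).
have z0 : 0 < Log m `^ (2 / 3) by rewrite powR_gt0.
have x0 := powR_ge0 m (1 / 3); have y0 := powR_ge0 t (1 / 3).
have Kx0 : 0 <= K * (m `^ (1 / 3) / Log m `^ (2 / 3)).
  by rewrite mulr_ge0 ?divr_ge0 // ltW.
have Ky0 : 0 <= K * t `^ (1 / 3) by rewrite mulr_ge0 // ltW.
rewrite mulrDr in H.
have q0 : 0 <= q by apply: le_trans H; rewrite addr_ge0.
have e : 1 / 3 * 3 = 1%:R :> R by field.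
split.
  rewrite -[m in _ * m]expr1 -(powR_cube m0 e).
  rewrite -(@powR_cube _ (2 / 3) 2) ?(ltW Lm) //; last by field.
  rewrite -!exprMn lerXn2r ?nnegrE ?mulr_ge0 // ?(ltW K0) ?(ltW z0) //.
  by rewrite -ler_pdivrMr // -mulrA; lra.
rewrite -[t in _ * t]expr1 -(powR_cube t0 e).
rewrite -!exprMn lerXn2r ?nnegrE //; lra.
Qed.
End Rescaling.

Theorem theorem1p5 :
  forall (R : realType) (rho A : R), 0 < rho -> 0 < A ->
  exists K p0 : R, 0 < K /\
  forall p : nat, p0 <= p%:R ->
  forall (V : finType) (F : rel V), simple_graph F ->
  #|nonisolated F|%:R <= p%:R `^ A ->
  forall (P : finType) (L : V -> {set P}), #|P| = p ->
  (forall v : V, rho * p%:R <= #|L v|%:R) ->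
  let m : R := #|edges F|%:R in
  let t : R := #|triangles F|%:R in
  K * (m `^ (1 / 3) / (Log m) `^ (2 / 3) + t `^ (1 / 3)) <= p%:R ->
  list_colorable F L.
Proof.
move=> R rho A rho0 A0.
pose eta := rho ^+ 3 / 256; pose sig := rho ^+ 2 / 1536.
have eta0 : 0 < eta by rewrite divr_gt0 ?exprn_gt0.
have sig0 : 0 < sig by rewrite divr_gt0 ?exprn_gt0.
pose eps := Num.min (rho ^+ 5 / 1024)
  (Num.min (eta / 4) (sig ^+ 2 * rho ^+ 2 / 12288)).
have eps0 : 0 < eps by rewrite !lt_min; apply/and3P; split; positivity.
pose B := (2 * A + 1) ^+ 2.
have B1 : 1 <= B by rewrite expr_ge1 //; lra.
have B0 : 0 < B by apply: lt_le_trans B1.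
pose K := 1 + 27 * B / eps; pose ell0 := 12 + 8 / rho + 4 / (rho ^+ 2 * eta).
have K1 : 1 <= K by rewrite lerDl; apply: ltW; positivity.
have K0 : 0 < K by apply: lt_le_trans K1.
(* 27 bounds both the 4 ordered pairs per edge and the 27 triples per triangle
   of the double counts; B is the price of replacing Log m by ln q. *)
have KB : 27 * B <= eps * K ^+ 3.
  apply: (@le_trans _ _ (eps * K)).
    have -> : eps * K = eps + 27 * B by rewrite /K; field; rewrite gt_eqF.
    by rewrite lerDr ltW.
  by rewrite ler_pM2l // ler_eXnr.
have h8 : 0 < 8 / rho by positivity.
have h4 : 0 < 4 / (rho ^+ 2 * eta) by positivity.
exists K, (expR ell0); split=> // p pbig V F [FC FI] few P L cardP bigL m t HK.
have q0 : 0 < p%:R :> R by apply: lt_le_trans pbig; rewrite expR_gt0.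
have pE : p%:R = expR (ln p%:R) :> R by rewrite lnK.
have ell_ge : ell0 <= ln p%:R by rewrite -ler_expR -pE.
have ell1 : 1 <= ln p%:R :> R by move: ell_ge; rewrite /ell0; lra.
have m0 : 0 <= m by exact: ler0n.
have t0 : 0 <= t by exact: ler0n.
have [Hm Ht] := cube_bounds K0 m0 t0 HK.
have LogB : Log m ^+ 2 <= B * ln p%:R ^+ 2.
  rewrite -exprMn ler_sqr ?nnegrE ?mulr_ge0 ?(le_trans ler01 (Log_ge1 _)) //; try lra.
  apply: (@Log_le_power _ _ #|nonisolated F|%:R) => //.
  by rewrite -natrX ler_nat edges_nonisolated.
have q3 : 0 < p%:R ^+ 3 :> R by rewrite exprn_gt0.
have bound x y : 0 <= x -> K ^+ 3 * x <= p%:R ^+ 3 * (B * y) ->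
    27 * x <= eps * p%:R ^+ 3 * y.
  move=> x0 H; rewrite -(ler_pM2l B0).
  have := ler_wpM2r x0 KB; have := ler_wpM2l (ltW eps0) H; lra.
apply: (@sparse_list_colorable R rho eps (ln p%:R) p) => //.
- by rewrite /eps ge_min lexx.
- by rewrite /eps !ge_min lexx orbT.
- by rewrite /eps !ge_min lexx !orbT.
- by apply: le_trans ell_ge; rewrite lerDl ltW.
- by apply: le_trans ell_ge; rewrite lerDr addr_ge0 // ltW.
- apply: (@le_trans _ _ (27 * m)).
    apply: (@le_trans _ _ (4 * m)); last by lra.
    by rewrite -natrM ler_nat adjpairs_edges.
  by apply: bound => //; apply: le_trans Hm _; rewrite ler_pM2l.
- apply: (@le_trans _ _ (27 * t)); first by rewrite -natrM ler_nat ordtri_triangles.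
  rewrite -[leRHS]mulr1; apply: bound => //; apply: le_trans Ht _.
  by rewrite mulr1 ler_pMr.
Qed.
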